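(* Assume that $\mathfrak{c}<\omega_\omega$ and $X$ is a regular space such that its co-diagonal $\Delta^c_X=(X\times X)\setminus\Delta_X$ is discretely Lindelöf. Then $\Delta^c_X$ is Lindelöf and hence $l(X\times X)=iw(X)=\omega$.
   Context: All spaces are topological spaces assumed to be $T_1$ (so regular includes $T_1$). $\mathfrak{c}=2^\omega$ is the cardinality of the continuum. $\Delta_X=\{(x,x):x\in X\}$ is the diagonal of $X$. A space is Lindelöf if every open cover has a countable subcover. A space $Z$ is discretely Lindelöf if the closure (in $Z$) of every discrete subset $D\subset Z$ (i.e. $D$ discrete in its subspace topology) is Lindelöf. $l(Z)$, the Lindelöf number, is the least cardinal $\kappa$ such that every open cover of $Z$ has a subcover of cardinality at most $\kappa$. For a Tychonoff space $X$, the $i$-weight $iw(X)$ is the least cardinal $\kappa$ such that $X$ has a weaker Tychonoff topology of weight $\kappa$. (Under the hypotheses $X$ is regular and Lindelöf, hence Tychonoff, so $iw(X)$ is defined.) As usual, values of cardinal functions are taken to be infinite, so ''$=\omega$'' means ''at most countable''. *)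

(* Defs.v *)
From mathcomp Require Import all_boot all_order all_algebra.
From mathcomp Require Import wochoice all_classical all_reals all_analysis.

Set Implicit Arguments.
Unset Strict Implicit.
Unset Printing Implicit Defensive.

Local Open Scope classical_set_scope.
Local Open Scope card_scope.

(* A cardinal is represented by any type having that cardinality. *)

Definition card_lt (K L : Type) : Prop :=
  [set: K] #<= [set: L] /\ ~ ([set: L] #<= [set: K]).

(* [(A, R)] is a well-ordering when the reflexive relation [R] well-orders the
   subset [A] of [T]; the values of [R] outside [A] are irrelevant. *)
Definition well_ordering {T : Type} : set (pred T * rel T) :=
  [set w | wo_chain w.2 w.1].

Definition order_iso {T : Type} (v w : pred T * rel T) : Prop :=
  exists2 f : T -> T, set_bij [set` v.1] [set` w.1] f &
    {in v.1 &, forall x y, w.2 (f x) (f y) = v.2 x y}.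

Definition order_type {T : Type} (w : pred T * rel T) : set (pred T * rel T) :=
  [set v | well_ordering v /\ order_iso w v].

(* The order types of the well-ordered subsets of [T] are the ordinals of
   cardinality at most that of [T]; for infinite [T] the set of these ordinals
   is the initial ordinal of the successor cardinal. *)
Definition hartogs (T : Type) : Type :=
  set_type [set order_type w | w in @well_ordering T].

Fixpoint aleph (n : nat) : Type := if n is m.+1 then hartogs (aleph m) else nat.

(* The disjoint union has cardinality [sup_n aleph_n], since each [aleph_n] is
   infinite and they are strictly increasing. *)
Definition aleph_omega : Type := {n : nat & aleph n}.

Definition continuum : Type := nat -> bool.

(* [K] is the least infinite cardinal satisfying [P]. *)
Definition least_infinite_card (P : Type -> Prop) (K : Type) : Prop :=
  [/\ infinite_set [set: K], P K &
      forall L : Type, infinite_set [set: L] -> P L -> [set: K] #<= [set: L]].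

Definition open_cover {T : topologicalType} (U : set (set T)) : Prop :=
  U `<=` open /\ \bigcup_(A in U) A = [set: T].

Definition subcovers_le (T : topologicalType) (K : Type) : Prop :=
  forall U : set (set T), open_cover U ->
    exists V : set (set T),
      [/\ V `<=` U, V #<= [set: K] & \bigcup_(A in V) A = [set: T]].

Definition lindelof_space (T : topologicalType) : Prop := subcovers_le T nat.

Definition is_lindelof_number (T : topologicalType) (K : Type) : Prop :=
  least_infinite_card (subcovers_le T) K.

Definition discrete_space (T : topologicalType) : Prop :=
  forall U : set T, open U.

(* [set_type A] carries the subspace topology, unlike [subspace A], which
   keeps all the points of the ambient space. *)
Definition discretely_lindelof (T : topologicalType) : Prop :=
  forall D : set T,
    discrete_space (set_type D) -> lindelof_space (set_type (closure D)).

Definition codiagonal (X : topologicalType) : set (X * X) := ~` diagonal.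
Arguments codiagonal : clear implicits.

Definition is_weight (T : topologicalType) (K : Type) : Prop :=
  least_infinite_card
    (fun L => exists2 B : set (set T), basis B & B #<= [set: L]) K.

(* [completely_regular_space] is phrased with uniform separators; by
   [uniform_separatorP] these are separations of a point from a closed set by a
   continuous function into [0, 1]. *)
Definition tychonoff_space (T : topologicalType) : Prop :=
  accessible_space T /\ completely_regular_space T.

Definition weaker_topology (X : topologicalType) (tau : Topological X) : Prop :=
  @open (Topological.Pack tau) `<=` @open X.

Definition is_i_weight (X : topologicalType) (K : Type) : Prop :=
  least_infinite_card
    (fun L => exists tau : Topological X,
       [/\ weaker_topology tau, tychonoff_space (Topological.Pack tau) &
           is_weight (Topological.Pack tau) L]) K.

(* Main.v *)
From HB Require Import structures.
Require Import Defs.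
From mathcomp Require Import all_boot all_order all_algebra.
From mathcomp Require Import wochoice all_classical all_reals all_analysis.
From mathcomp Require Import Rstruct Rstruct_topology.

(** Write [Z] for the co-diagonal of [X] and [c] for the continuum.  The heart of
    the proof is a countable family of open sets [U n] such that any two points
    [p <> q] satisfy [U n q] and [~ closure (U n) p] for some [n].

    Everything rests on one construction ([greedy_discrete]): well-order some
    requirements on points and meet them one after the other, each time outside
    the closure of the points already chosen and outside neighbourhoods of them.
    The chosen set is discrete, and each requirement is met by one of its points
    or can only be met inside its closure or these neighbourhoods.  Discrete
    Lindelöfness turns such sets into countable covers.

    A first consequence is that closures of discrete subsets of [X] have size at
    most [c] ([closure_discrete_continuum]).  A second one is that increasing
    open covers of [Z] of uncountable cofinality stabilize
    ([increasing_cover_stabilizes]).  Since [c < aleph_omega], the cardinal [c] is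
    bounded by some [aleph n], and climbing through the finitely many successor
    cardinals shows that every open cover of [Z] of size at most [c] has a
    countable subcover ([covers_reduce_continuum]).

    It remains to find a separating family of size [c]
    ([separating_family_continuum]).  One refines a family over and over along a
    well-order longer than the continuum ([refine_family]).  If no stage
    separates all the pairs, then, by stabilization, a single pair is missed by
    all the stages, and it produces a right-separated sequence of points of [X]
    longer than [c]; a discrete subset of it is bounded but has a whole tail of
    the sequence in its closure, which contradicts the bound on closures of
    discrete sets.

    The countable separating family embeds [X] in the continuum, so covers of
    [Z] reduce to covers of size [c] and [Z] is Lindelöf.  Then [X] and its square
    are Lindelöf and [X] is normal; Urysohn functions for countably many pairs of
    disjoint closures separate the points of [X] and induce a weaker
    second-countable Tychonoff topology. *)

Set Implicit Arguments.
Unset Strict Implicit.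
Unset Printing Implicit Defensive.
Import Order.TTheory GRing.Theory Num.Theory.
Import numFieldNormedType.Exports.
Local Open Scope classical_set_scope.
Local Open Scope card_scope.

(** * Cardinalities *)

Lemma card_le_injective (T U : Type) (A : set T) (B : set U) (f : T -> U) :
  (forall x, A x -> B (f x)) ->
  (forall x y, A x -> A y -> f x = f y -> x = y) -> A #<= B.
Proof.
move=> fAB fI; have fA : f @` A #= A.
  by apply: inj_card_eq => x y /set_mem Ax /set_mem Ay; exact: fI.
by rewrite -(card_le_eql fA); apply: subset_card_le => _ [x Ax <-]; exact: fAB.
Qed.

Lemma card_le_injectiveP (T K : Type) (A : set T) (k0 : K) :
  A #<= [set: K] ->
  exists f : T -> K, forall x y, A x -> A y -> f x = f y -> x = y.
Proof.
pose K' : pointedType := HB.pack {classic K} (isPointed.Build {classic K} k0).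
move=> /(@pcard_injP _ K') [f fI]; exists f => x y Ax Ay.
by apply: fI; exact: mem_set.
Qed.

Lemma card_le_enum (T K : Type) (A : set T) (a0 : T) :
  A a0 -> A #<= [set: K] ->
  exists e : K -> T, range e = A.
Proof.
move=> Aa0 /pfcard_geP [A0|[f]]; first by move: Aa0; rewrite A0.
exists f; rewrite eqEsubset; split=> [_ [k _ <-]|a Aa]; first exact: funS.
by have [k _ <-] := @surj _ _ _ _ f a Aa; exists k.
Qed.

Lemma card_le_bigcup (I T K L : Type) (J : set I) (F : I -> set T)
    (k0 : K) (l0 : L) :
  J #<= [set: K] -> (forall i, J i -> F i #<= [set: L]) ->
  \bigcup_(i in J) F i #<= [set: K * L].
Proof.
move=> /(card_le_injectiveP k0) [f fI] FL.
have /choice [g gI] : forall i, exists g : T -> L,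
    J i -> forall x y, F i x -> F i y -> g x = g y -> x = y.
  move=> i; have [Ji|nJi] := pselect (J i); last by exists (fun=> l0).
  by have [g gI] := card_le_injectiveP l0 (FL i Ji); exists g.
have /choice [h hP] : forall x, exists i : option I,
    (\bigcup_(i in J) F i) x -> exists j, [/\ i = Some j, J j & F j x].
  move=> x; have [[i Ji Fix]|nx] := pselect ((\bigcup_(i in J) F i) x).
    by exists (Some i) => _; exists i.
  by exists None.
apply: (@card_le_injective _ _ _ _
  (fun x => if h x is Some i then (f i, g i x) else (k0, l0))) => //.
move=> x y /hP [i [-> Ji Fix]] /hP [j [-> Jj Fjy]] [fij].
have {}fij : i = j by exact: fI.
by move: Fjy; rewrite -{}fij => Fiy; exact: gI.
Qed.

Lemma continuum_nat : [set: nat] #<= [set: continuum].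
Proof.
apply: (@card_le_injective _ _ _ _ (fun n m => m == n)) => // m n _ _.
by move=> /(congr1 (fun c => c n)) /=; rewrite eqxx => /eqP ->.
Qed.

(** A countable sequence of binary sequences is a binary double sequence, and
    [pickle] codes pairs of indices by single ones. *)
Lemma continuum_pow_nat : [set: nat -> continuum] #<= [set: continuum].
Proof.
pose code (f : nat -> continuum) : continuum :=
  fun n => if unpickle n is Some (i, j) then f i j else false.
apply: (@card_le_injective _ _ _ _ code) => // f g _ _ fg.
apply/funext => i; apply/funext => j.
by have := congr1 (fun c => c (pickle (i, j))) fg; rewrite /code pickleK.
Qed.

Lemma continuum_prod : [set: continuum * continuum] #<= [set: continuum].
Proof.
apply: card_le_trans continuum_pow_nat.
apply: (@card_le_injective _ _ _ _
  (fun c n => if n is 0%N then c.1 else c.2)) => // -[c d] [c' d'] _ _ /= cd.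
by rewrite (congr1 (fun f => f 0%N) cd) (congr1 (fun f => f 1%N) cd).
Qed.

Lemma continuum_bigcup (I T : Type) (J : set I) (F : I -> set T) :
  J #<= [set: continuum] -> (forall i, J i -> F i #<= [set: continuum]) ->
  \bigcup_(i in J) F i #<= [set: continuum].
Proof.
move=> JC FC; apply: card_le_trans continuum_prod.
by apply: card_le_bigcup => //; exact: (fun=> false).
Qed.

Lemma countable_le_continuum (T : Type) (A : set T) :
  countable A -> A #<= [set: continuum].
Proof. by move=> cA; exact: card_le_trans cA continuum_nat. Qed.

Lemma continuumU (T : Type) (A B : set T) :
  A #<= [set: continuum] -> B #<= [set: continuum] ->
  A `|` B #<= [set: continuum].
Proof.
move=> AC BC; rewrite -bigcup2E.
apply: continuum_bigcup => [|[|[|i]] _ //=].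
exact: countable_le_continuum.
Qed.

Lemma cantor (T : Type) : ~ ([set: set T] #<= [set: T]).
Proof.
move=> H; have [e eT] := card_le_enum (I : [set: set T] set0) H.
have [x _ ex] : range e [set x | ~ e x x] by rewrite eT.
have nx : ~ e x x by move=> exx; have := exx; rewrite {1}ex; apply.
by apply: (nx); rewrite ex.
Qed.

(** * Well-orders *)

Definition strict_wo (L : Type) (lt : L -> L -> Prop) : Prop :=
  [/\ well_founded lt, (forall x y z, lt x y -> lt y z -> lt x z) &
      forall x y, [\/ lt x y, x = y | lt y x]].

Lemma strict_wo_irr (L : Type) (lt : L -> L -> Prop) x :
  strict_wo lt -> ~ lt x x.
Proof. by case=> wf _ _; elim/(well_founded_ind wf): x => x IH xx; exact: (IH x). Qed.

Lemma strict_wo_min (L : Type) (lt : L -> L -> Prop) (P : L -> Prop) :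
  strict_wo lt -> (exists x, P x) ->
  exists x, P x /\ forall y, lt y x -> ~ P y.
Proof.
case=> wf _ _ [x]; elim/(well_founded_ind wf): x => x IH Px.
have [[y [yx Py]]|nP] := pselect (exists y, lt y x /\ P y); first exact: IH yx Py.
by exists x; split => // y yx Py; apply: nP; exists y.
Qed.

Lemma strict_wo_pullback (L M : Type) (lt : L -> L -> Prop) (f : M -> L) :
  injective f -> strict_wo lt -> strict_wo (fun x y => lt (f x) (f y)).
Proof.
move=> fI [wf tr tot]; split.
- have H : forall l x, f x = l -> Acc (fun x y => lt (f x) (f y)) x.
    elim/(well_founded_ind wf) => l IH x fx; constructor => y.
    by rewrite fx => /IH; apply.
  by move=> x; exact: H.
- by move=> x y z; exact: tr.
- by move=> x y; case: (tot (f x) (f y)) => [||] H; 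
    [exact: Or31|apply: Or32; exact: fI|exact: Or33].
Qed.

(** The link with reflexive relations that well-order a subset, the form used for
    order types. *)
Lemma strict_wo_of_wo_chain (T : eqType) (R : rel T) (C : {pred T}) :
  wo_chain R C -> strict_wo (fun x y : {x | x \in C} =>
    R (sval x) (sval y) /\ sval x <> sval y).
Proof.
move=> wR; have anti := wo_chain_antisymmetric wR.
have tot := wo_chainW wR.
have min (P : {x | x \in C} -> Prop) : (exists x, P x) ->
    exists x, P x /\ forall y, P y -> R (sval x) (sval y).
  move=> [[x xC] Px].
  have [||z [[zA zmin] _]] := wR (mem [set t | exists tC : t \in C, P (exist _ t tC)]).
  - by move=> t /set_mem [].
  - by exists x; apply: mem_set; exists xC.
  case/set_mem: zA => zC Pz; exists (exist _ z zC); split => // -[y yC] Py /=.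
  by apply: zmin; apply: mem_set; exists yC.
have asym (x y : {x | x \in C}) : R (sval x) (sval y) -> R (sval y) (sval x) -> sval x = sval y.
  by move=> xy yx; apply: anti; rewrite ?(svalP x) ?(svalP y) ?xy.
split.
- move=> x; apply: contrapT => nx.
  have [|m [nm mmin]] := min (fun x => ~ Acc (fun x y : {x | x \in C} =>
    R (sval x) (sval y) /\ sval x <> sval y) x); first by exists x.
  apply: nm; constructor => y [ym nym]; apply: contrapT => /mmin my.
  by apply: nym; exact: asym.
- move=> x y z [xy nxy] [yz nyz].
  (* Transitivity is read off the least element of the triple. *)
  have [|m [mxyz mmin]] := min (fun t => [\/ t = x, t = y | t = z]).
    by exists x; exact: Or31.
  have mx := mmin x (Or31 _ _ erefl).
  have my := mmin y (Or32 _ _ erefl).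
  have mz := mmin z (Or33 _ _ erefl).
  case: mxyz => mE; rewrite {}mE in mx my mz.
  + by split => // xz; apply: nxy; apply: asym => //; rewrite xz.
  + by case: nxy; exact: asym.
  + by case: nyz; exact: asym.
- move=> x y; have [xy|/eqP xy] := eqVneq (sval x) (sval y).
    by apply: Or32; move: x y xy => [x xC] [y yC] /= xy; apply: eq_exist.
  case/orP: (tot _ _ (svalP x) (svalP y)) => H; first exact: Or31.
  by apply: Or33; split => // /esym.
Qed.

Lemma strict_wo_exists (L : Type) : exists lt : L -> L -> Prop, strict_wo lt.
Proof.
pose E : eqType := {classic L}.
have [R wR] := well_ordering_principle E.
have wT : wo_chain R (predT : {pred E}) by move=> A _; exact: wR.
have W := strict_wo_of_wo_chain wT.
pose f (x : L) : {x : E | x \in predT} := exist _ x isT.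
by eexists; apply: (strict_wo_pullback (f := f)) W => x y [].
Qed.

(** Definition by well-founded recursion, given as the choice of a value related to
    the values below it.  The relation [P] receives a total function, hence the
    condition that it depends only on the restriction to the smaller arguments. *)
Lemma wo_recursion (L : Type) (lt : L -> L -> Prop) (A : Type)
    (P : L -> (L -> A) -> A -> Prop) (a0 : A) :
  strict_wo lt ->
  (forall x h h' a, (forall y, lt y x -> h y = h' y) -> P x h a -> P x h' a) ->
  (forall x h, exists a, P x h a) -> exists c : L -> A, forall x, P x c (c x).
Proof.
move=> [wf _ _] Ploc Pex.
have /choice [F FP] : forall xh : L * (L -> A), exists a, P xh.1 xh.2 a.
  by move=> xh; exact: Pex.
pose G x (h : forall y, lt y x -> A) : A :=
  F (x, fun y => if pselect (lt y x) is left yx then h y yx else a0).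
exists (Fix wf (fun=> A) G) => x; rewrite Fix_eq => [|y f g fg].
  by apply: (Ploc x _ _ _ _ (FP (x, _))) => y yx /=; case: pselect.
by congr F; congr pair; apply/funext => z; case: pselect.
Qed.

(** Cutting a well-order of a large set at the first point that has too many
    predecessors. *)
Lemma wo_short (Om K : Type) :
  ~ ([set: Om] #<= [set: K]) ->
  exists (L : Type) (lt : L -> L -> Prop), [/\ strict_wo lt,
    ~ ([set: L] #<= [set: K]), (forall x, [set y | lt y x] #<= [set: K]) &
    [set: L] #<= [set: Om]].
Proof.
move=> nK; have [lt wo] := strict_wo_exists Om.
have [ex|nex] := pselect (exists x, ~ ([set y | lt y x] #<= [set: K])); last first.
  by exists Om, lt; split => // x; apply: contrapT => nx; apply: nex; exists x.
have [m [mK mmin]] := strict_wo_min wo ex.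
exists (set_type [set y | lt y m]), (fun x y => lt (set_val x) (set_val y)).
split.
- by apply: strict_wo_pullback wo; exact: val_inj.
- by move=> H; apply: mK; rewrite -(card_le_eql (card_setT _)).
- move=> [x /= xm]; apply: card_le_trans (contrapT (mmin x (set_mem xm))).
  by apply: (@card_le_injective _ _ _ _ set_val) => // u v _ _; exact: val_inj.
- by apply: (@card_le_injective _ _ _ _ set_val) => // u v _ _; exact: val_inj.
Qed.

(** This is the regularity of a successor cardinal: if [J] were unbounded, [L] would
    be the union of the initial segments at the points of [J]. *)
Lemma wo_short_bounded (L M K : Type) (lt : L -> L -> Prop) (m0 : M) (k0 : K)
    (J : set L) :
  [set: M * K] #<= [set: K] ->
  strict_wo lt -> ~ ([set: L] #<= [set: K]) ->
  (forall x, [set y | lt y x] #<= [set: K]) ->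
  J #<= [set: M] -> exists x, forall j, J j -> ~ lt x j.
Proof.
move=> MK wo nL seg JM; apply: contrapT => unb; apply: nL.
apply: card_le_trans MK.
apply: card_le_trans (card_le_bigcup m0 k0 JM (fun j _ => seg j)).
apply: subset_card_le => x _; apply: contrapT => nx; apply: unb; exists x => j Jj xj.
by apply: nx; exists j.
Qed.

(** * Discrete subsets and Lindelöf subspaces *)

Lemma discrete_space_isolated (Z : topologicalType) (D : set Z) :
  (forall z, D z -> exists O, [/\ open O, O z & O `&` D `<=` [set z]]) ->
  discrete_space (set_type D).
Proof.
move=> iso U; have /choice [ O OP] : forall u : set_type D, exists O : set Z,
    [/\ open O, O (set_val u) & O `&` D `<=` [set set_val u]].
  by move=> u; apply: iso; exact: set_valP.
exists (\bigcup_(u in U) O u).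
  by apply: bigcup_open => u _; case: (OP u).
rewrite eqEsubset; split=> [v [u Uu Ouv]|u Uu]; last by exists u => //; case: (OP u).
have [_ _ sub] := OP u; suff /val_inj -> : set_val v = set_val u by [].
by apply: sub; split => //; exact: set_valP.
Qed.

Lemma isolated_of_discrete_space (Z : topologicalType) (D : set Z) (z : Z) :
  discrete_space (set_type D) -> D z ->
  exists O, [/\ open O, O z & O `&` D `<=` [set z]].
Proof.
move=> dD Dz; pose u : set_type D := SigSub (mem_set Dz).
have [ O oO OE] := dD [set u]; exists O; split => //.
  by have : (set_val @^-1` O) u by rewrite OE.
move=> y [Oy Dy]; pose v : set_type D := SigSub (mem_set Dy).
have : (set_val @^-1` O) v by [].
by rewrite OE => /(congr1 set_val).
Qed.

Lemma lindelof_sequence (Z : topologicalType) (I : Type) (O : I -> set Z) (i0 : I) :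
  lindelof_space Z -> (forall i, open (O i)) -> \bigcup_i O i = setT ->
  exists s : nat -> I, \bigcup_n O (s n) = setT.
Proof.
move=> lZ oO OT; have [[z _]|nZ] := pselect ([set: Z] !=set0); last first.
  by exists (fun=> i0); apply/seteqP; split => // z _; case: nZ; exists z.
have [|V [VO Vn VT]] := lZ (range O).
  split; first by move=> _ [i _ <-].
  rewrite -OT; apply/seteqP; split => x; first by move=> [_ [i _ <-] Ox]; exists i.
  by move=> [i _ Ox]; exists (O i) => //; exists i.
have [B VB _] : (\bigcup_(B in V) B) z by rewrite VT.
have [e eV] := card_le_enum VB Vn.
have /choice [s sP] : forall n, exists i, O i = e n.
  by move=> n; have [|i _ <-] := VO (e n); [rewrite -eV; exists n|exists i].
exists s; apply/seteqP; split => // x _.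
have [B'] : (\bigcup_(B in V) B) x by rewrite VT.
by rewrite -eV => -[n _ <-]; rewrite -sP => Ox; exists n.
Qed.

Lemma lindelof_subcover (Z : topologicalType) (A : set Z) (I : Type)
    (O : I -> set Z) (i0 : I) :
  lindelof_space (set_type A) -> (forall i, open (O i)) ->
  A `<=` \bigcup_i O i -> exists s : nat -> I, A `<=` \bigcup_n O (s n).
Proof.
move=> lA oO AO.
have [||s sT] := @lindelof_sequence _ I
  (fun i => (set_val : set_type A -> Z) @^-1` O i) i0 lA.
- by move=> i; exists (O i).
- apply/seteqP; split => // u _; have [i _ Oiu] := AO _ (set_valP u).
  by exists i.
exists s => z Az; have : [set: set_type A] (SigSub (mem_set Az)) by [].
by rewrite -sT => -[n _ Oz]; exists n.
Qed.

(** A cover is refined to a neighbourhood assignment by choosing a member at each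
    point; this makes the points themselves the indices of the cover. *)
Lemma lindelof_of_assignments (Z : topologicalType) :
  (forall (z0 : Z) (O : Z -> set Z), (forall z, open (O z)) -> (forall z, O z z) ->
    exists s : nat -> Z, \bigcup_n O (s n) = setT) -> lindelof_space Z.
Proof.
move=> H U [oU UT]; have [[z0 _]|nZ] := pselect ([set: Z] !=set0); last first.
  exists set0; split; [by []|exact: card_ge0|].
  by apply/seteqP; split => // z _; case: nZ; exists z.
have /choice [ O OP] : forall z, exists A, U A /\ A z.
  move=> z; have [A UA Az] : (\bigcup_(A in U) A) z by rewrite UT.
  by exists A.
have [|z|s sT] := H z0 O; [by move=> z; apply: oU; case: (OP z)|by case: (OP z)|].
exists (range (O \o s)); split.
- by move=> _ [n _ <-]; case: (OP (s n)).
- exact: card_image_le.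
- rewrite -sT; apply/seteqP; split => z; first by move=> [_ [n _ <-] Oz]; exists n.
  by move=> [n _ Oz]; exists (O (s n)) => //; exists n.
Qed.

(** Points are chosen along the well-order, each one, when there is any, outside
    the closure of the earlier ones and outside the neighbourhoods attached to
    them.  A chosen point is then isolated from the later ones by its own
    neighbourhood and from the earlier ones by the complement of their closure. *)
Lemma greedy_discrete (Z : topologicalType) (I : Type) (lt : I -> I -> Prop)
    (S : I -> set Z) (W : Z -> set Z) :
  strict_wo lt -> (forall i z, S i z -> open (W z) /\ W z z) ->
  exists D : set Z, [/\ discrete_space (set_type D), D `<=` \bigcup_i S i,
    D #<= [set: I] &
    forall i, (D `&` S i !=set0) \/ S i `<=` closure D `|` \bigcup_(z in D) W z].
Proof.
move=> wo SW.
pose before (i : I) (h : I -> option Z) := [set z | exists j, lt j i /\ h j = Some z].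
pose free i h := S i `\` (closure (before i h) `|` \bigcup_(z in before i h) W z).
pose P i h (a : option Z) := if a is Some z then free i h z else free i h = set0.
have [||c cP] := @wo_recursion I lt (option Z) P None wo.
- move=> i h h' a hh'; suff : before i h = before i h' by rewrite /P /free => ->.
  by rewrite eqEsubset; split=> z [j [ji hj]]; exists j; move: hj; rewrite hh'.
- move=> i h; have [[z fz]|nf] := pselect (free i h !=set0); first by exists (Some z).
  by exists None; rewrite /P; apply/seteqP; split => // z fz; apply: nf; exists z.
pose D := [set z | exists i, c i = Some z].
have bD i : before i c `<=` D by move=> z [j [_ cj]]; exists j.
have cS i z : c i = Some z -> free i c z by move=> ci; have := cP i; rewrite ci.
exists D; split.
- apply: discrete_space_isolated => z [i ciz].
  have [Siz nz] := cS _ _ ciz; have [oW Wz] := SW _ _ Siz.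
  exists (W z `&` ~` closure (before i c)); split.
  + by apply: openI => //; apply: closed_openC; exact: closed_closure.
  + by split => // cz; apply: nz; left.
  + move=> y [[Wzy nby] [j cjy]]; have [_ _ tot] := wo.
    case: (tot i j) => ij.
    * have [_ ny] := cS _ _ cjy; case: ny; right; exists z => //.
      by exists i; rewrite ciz.
    * by move: cjy; rewrite -ij ciz => -[->].
    * by case: nby; apply: subset_closure; exists j.
- by move=> z [i /cS [Siz _]]; exists i.
- have /choice [f fP] : forall z, exists i : option I, D z -> exists j, i = Some j /\ c j = Some z.
    move=> z; have [[j cj]|nD] := pselect (D z); first by exists (Some j) => _; exists j.
    by exists None => /nD.
  apply: (@card_le_trans _ _ _ (some @` [set: I])); last exact: card_image_le.
  apply: (@card_le_injective _ _ _ _ f); first by move=> z /fP [j [-> _]]; exists j.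
  by move=> z y /fP [j [-> cj]] /fP [k [-> ck]] [jk]; move: cj; rewrite jk ck => -[].
- move=> i; case ci : (c i) => [z|].
    by left; exists z; split; [exists i|have [] := cS _ _ ci].
  right => z Siz; have := cP i; rewrite ci /P => f0.
  apply: contrapT => nz; suff : free i c z by rewrite f0.
  split => // -[cz|[y by_ Wz]]; apply: nz; first by left; exact: (closureS (bD i)).
  by right; exists y => //; exact: (bD i).
Qed.

(** If no [O x] is the whole space, choose greedily a point outside each [O x] in
    turn, with the first member of the cover that contains it as its
    neighbourhood.  By the hypothesis on the cofinality, the closure of the chosen
    set lies in a single [O x], and so do the neighbourhoods of its points: the
    complement of this [O x] contains no chosen point although nothing prevented
    choosing one there. *)
Lemma increasing_cover_stabilizes (Z : topologicalType) (L : Type)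
    (lt : L -> L -> Prop) (O : L -> set Z) (x0 : L) :
  discretely_lindelof Z -> strict_wo lt ->
  (forall s : nat -> L, exists x, forall n, ~ lt x (s n)) ->
  (forall x, open (O x)) -> (forall x y, lt x y -> O x `<=` O y) ->
  \bigcup_x O x = setT -> exists x, O x = setT.
Proof.
move=> dlZ wo bnd oO inc cov; apply: contrapT => nT.
have /choice [m mP] : forall z, exists x, O x z /\ forall y, lt y x -> ~ O y z.
  move=> z; apply: strict_wo_min wo _.
  by have : setT z by []; rewrite -cov => -[x _ Oz]; exists x.
have [|D [dD _ _ DS]] := @greedy_discrete Z L lt (fun x => ~` O x) (fun z => O (m z)) wo.
  by move=> x z _; split => //; case: (mP z).
have [|s Ds] := lindelof_subcover x0 (dlZ _ dD) oO; first by rewrite cov.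
have [x xs] := bnd s.
have inc' y : ~ lt x y -> O y `<=` O x.
  by move=> nxy; case: wo => _ _ tot; case: (tot x y) => [/nxy//|->|/inc].
have Dx : closure D `<=` O x by move=> z /Ds [n _ Oz]; exact: inc' (xs n) _ Oz.
case: (DS x) => [[z [Dz nOz]]|sub].
  by apply: nOz; apply: Dx; exact: subset_closure.
apply: nT; exists x; apply/seteqP; split => // z _; apply: contrapT => nOz.
case: (sub z nOz) => [/Dx //|[y Dy Oyz]]; apply: nOz; apply: inc' Oyz => xm.
have [_ /(_ x xm)] := mP y; apply; apply: Dx; exact: subset_closure.
Qed.

(** * Open covers of size less than aleph omega *)

(** The rank of [a] is the least element of [J] that is not the rank of a predecessor
    of [a]. *)
Lemma wo_rank (M J : Type) (ltM : M -> M -> Prop) (lt : J -> J -> Prop) :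
  strict_wo ltM -> strict_wo lt -> ~ ([set: J] #<= [set: M]) ->
  exists m (r : M -> J), (forall a b, ltM a b -> lt (r a) (r b)) /\
    range r = [set j | lt j m].
Proof.
move=> woM wo nJM; have [wfM trM totM] := woM; have [wf tr tot] := wo.
have [j0 _] : [set: J] !=set0.
  by apply/set0P/eqP => J0; apply: nJM; rewrite J0; exact: card_ge0.
(* Too few ranks are taken at any stage to exhaust [J]. *)
have omit (A : set M) (r : M -> J) : exists j, ~ (r @` A) j /\
    forall i, lt i j -> (r @` A) i.
  have [|j [nj jmin]] := strict_wo_min (P := fun j => ~ (r @` A) j) wo.
    apply: contrapT => H; apply: nJM; apply: card_le_trans (card_leT A).
    apply: card_le_trans (card_image_le r A); apply: subset_card_le => j _.
    by apply: contrapT => nj; apply: H; exists j.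
  by exists j; split => // i /jmin /contrapT.
have [||r rP] := @wo_recursion M ltM J (fun a r j =>
    ~ (r @` [set b | ltM b a]) j /\ forall i, lt i j -> (r @` [set b | ltM b a]) i) j0 woM.
- move=> a r r' j rr'; suff -> : r @` [set b | ltM b a] = r' @` [set b | ltM b a] by [].
  by apply: eq_imagel => b; exact: rr'.
- by move=> a r; exact: omit.
have [m [nm mmin]] := omit setT r.
exists m, r; split.
  move=> b a ba; have [nra ra] := rP a; have [nrb rb] := rP b.
  case: (tot (r b) (r a)) => // [rba|rab]; first by case: nra; exists b.
  by have [c cb rc] := rb _ rab; case: nra; exists c => //; exact: trM ba.
apply/seteqP; split=> [_ [a _ <-]|j /mmin //].
case: (tot (r a) m) => [//|ram|mra]; first by case: nm; exists a.
by have [_ ra] := rP a; have [c _ rc] := ra _ mra; case: nm; exists c.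
Qed.

Lemma order_iso_trans (T : Type) (u v w : pred T * rel T) :
  order_iso u v -> order_iso v w -> order_iso u w.
Proof.
move=> [f fb fR] [g gb gR]; exists (g \o f); first exact: set_bij_comp fb gb.
have fv x : x \in u.1 -> f x \in v.1 by case: fb => fun_f _ _ xu; exact: fun_f.
by move=> x y xu yu /=; rewrite gR ?fR //; exact: fv.
Qed.

(** A well-order of a subset of [T] is determined up to isomorphism by the initial
    segment of a fixed well-order of [J] formed by its ranks, hence by a point of
    [J]. *)
Lemma hartogs_least (T J : Type) :
  ~ ([set: J] #<= [set: T]) -> [set: hartogs T] #<= [set: J].
Proof.
move=> nJT; have [lt wo] := strict_wo_exists J.
pose ltw (w : pred T * rel T) (x y : {x | x \in w.1}) :=
  w.2 (sval x) (sval y) /\ sval x <> sval y.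
have wow w : well_ordering w -> strict_wo (ltw w).
  exact: (@strict_wo_of_wo_chain {classic T} w.2 w.1).
have [j0 _] : [set: J] !=set0.
  by apply/set0P/eqP => J0; apply: nJT; rewrite J0; exact: card_ge0.
have /choice [m mP] : forall w, exists m, well_ordering w ->
    exists r : {x | x \in w.1} -> J,
    (forall a b, ltw w a b -> lt (r a) (r b)) /\ range r = [set j | lt j m].
  move=> w; have [ww|nw] := pselect (well_ordering w); last by exists j0.
  have [|m H] := wo_rank (wow w ww) wo; last by exists m.
  move=> H; apply: nJT; apply: card_le_trans H _.
  apply: (@card_le_injective _ _ _ _ sval) => // -[x xw] [y yw] _ _ /= xy.
  exact: eq_exist.
pose pt (w : pred T * rel T) x (xw : x \in w.1) := exist (fun x => x \in w.1) x xw.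
have iso v w : well_ordering v -> well_ordering w -> m v = m w -> order_iso v w.
  move=> vv ww mvw; have [r [rmon rim]] := mP v vv; have [q [qmon qim]] := mP w ww.
  have transfer (u1 u2 : pred T * rel T) (r1 : {x | x \in u1.1} -> J)
      (r2 : {x | x \in u2.1} -> J) a b c d : well_ordering u2 ->
      (forall a b, ltw u1 a b -> lt (r1 a) (r1 b)) ->
      (forall a b, ltw u2 a b -> lt (r2 a) (r2 b)) ->
      r1 a = r2 c -> r1 b = r2 d -> u1.2 (sval a) (sval b) ->
      u2.2 (sval c) (sval d).
    move=> wu2 mon1 mon2 ac bd ab.
    have [_ _ tot2] := wow u2 wu2.
    have refl := @wo_chain_reflexive {classic T} u2.2 u2.1 wu2.
    have r2I : r2 c = r2 d -> c = d.
      by case: (tot2 c d) => [/mon2|//|/mon2] + E; rewrite E => /(strict_wo_irr wo).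
    have [eab|/eqP nab] := eqVneq (sval a : {classic T}) (sval b).
      have eab' : a = b by move: a b eab {ac bd ab} => [a ?] [b ?] /= ?; exact: eq_exist.
      have -> : c = d by apply: r2I; rewrite -ac -bd eab'.
      exact: (refl _ (svalP d)).
    have := mon1 a b (conj ab nab); rewrite ac bd => cd.
    case: (tot2 c d) => [[]//|cd'|/mon2 dc].
      by move: cd; rewrite cd' => /(strict_wo_irr wo).
    by case: (strict_wo_irr wo (x := r2 c)); case: wo => _ tr _; exact: tr dc.
  have image (u1 u2 : pred T * rel T) (r1 : {x | x \in u1.1} -> J)
      (r2 : {x | x \in u2.1} -> J) x (xu : x \in u1.1) :
      range r1 = [set j | lt j (m v)] -> range r2 = [set j | lt j (m v)] ->
      exists y (yu : y \in u2.1), r2 (exist _ y yu) = r1 (exist _ x xu).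
    move=> im1 im2; have : range r1 (r1 (exist _ x xu)) by eexists.
    by rewrite im1 -im2 => -[[y yu] _ E]; exists y, yu.
  have /choice [f fP] : forall x, exists y, forall xv : x \in v.1,
      exists yw : y \in w.1, q (exist _ y yw) = r (exist _ x xv).
    move=> x; have [xv|nx] := pselect (x \in v.1); last by exists x.
    have [|y [yw E]] := image v w r q x xv rim; first by rewrite mvw.
    by exists y => xv'; exists yw; rewrite E; congr r; exact: eq_exist.
  have fiso : {in v.1 &, forall x y, w.2 (f x) (f y) = v.2 x y}.
    move=> x y xv yv; have [fxw Ex] := fP x xv; have [fyw Ey] := fP y yv.
    apply/idP/idP => H.
      exact: (transfer w v q r (pt w _ fxw) (pt w _ fyw) (pt v _ xv) (pt v _ yv) vv qmon rmon Ex Ey H).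
    exact: (transfer v w r q (pt v _ xv) (pt v _ yv) (pt w _ fxw) (pt w _ fyw) ww rmon qmon (esym Ex) (esym Ey) H).
  exists f => //; split.
  - by move=> x xv; have [] := fP x xv.
  - move=> x y /set_mem xv /set_mem yv fxy.
    have [fxw Ex] := fP x xv; have [fyw Ey] := fP y yv.
    have : r (exist _ x xv) = r (exist _ y yv).
      by rewrite -Ex -Ey; congr q; exact: eq_exist.
    have [_ _ totv] := wow v vv => rxy.
    case: (totv (exist _ x xv) (exist _ y yv)) => [/rmon|[]//|/rmon];
      by rewrite rxy => /(strict_wo_irr wo).
  - move=> y yw.
    have [|x [xv E]] := image w v q r y yw _ rim; first by rewrite mvw.
    exists x => //; have [fxw Ex] := fP x xv.
    have [_ _ totw] := wow w ww.
    case: (totw (exist _ (f x) fxw) (exist _ y yw)) => [/qmon|[]//|/qmon];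
      by rewrite Ex E => /(strict_wo_irr wo).
have /choice [W WP] : forall h : hartogs T, exists w, well_ordering w /\ order_type w = set_val h.
  by move=> h; have [w ww wh] := set_valP h; exists w.
apply: (@card_le_injective _ _ _ _ (fun h => m (W h))) => // h k _ _ mhk.
have [wh hE] := WP h; have [wk kE] := WP k.
apply: val_inj; rewrite -[LHS]hE -[RHS]kE.
apply/seteqP; split => v [vv hv]; split => //.
  by apply: order_iso_trans hv; exact: iso.
by apply: order_iso_trans hv; exact: iso.
Qed.

(** For every [T] a countable union of sets of size at most [nat * T] is again that
    small, which is why the induction on [n] below is about [nat * aleph n]. *)
Lemma nat_prod_absorb (T : Type) :
  [set: nat * (nat * T)] #<= [set: nat * T].
Proof.
apply: (@card_le_injective _ _ _ _ (fun x => (pickle (x.1, x.2.1), x.2.2))) => //.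
move=> [m [n t]] [m' [n' t']] _ _ /= [] /(pcan_inj (@pickleK _)) [-> ->] ->.
by [].
Qed.

Lemma nat_prod_le (T U : Type) (u0 : U) :
  [set: T] #<= [set: U] -> [set: nat * T] #<= [set: nat * U].
Proof.
move=> /(card_le_injectiveP u0) [f fI].
apply: (@card_le_injective _ _ _ _ (fun x => (x.1, f x.2))) => //.
by move=> [m t] [n t'] _ _ /= [-> /fI ->].
Qed.

Lemma nat_prod_ge (T : Type) : [set: T] #<= [set: nat * T].
Proof. by apply: (@card_le_injective _ _ _ _ (pair 0%N)) => // t t' _ _ []. Qed.

Definition covers_reduce (Z : topologicalType) (K : Type) : Prop :=
  forall O : K -> set Z, (forall k, open (O k)) -> \bigcup_k O k = setT ->
  exists s : nat -> K, \bigcup_n O (s n) = setT.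

Lemma covers_reduce_le (Z : topologicalType) (K M : Type) (m0 : M) :
  [set: M] #<= [set: K] -> covers_reduce Z K -> covers_reduce Z M.
Proof.
move=> MK red O oO OT; have [e eT] := card_le_enum (I : [set: M] m0) MK.
have [||s sT] := red (O \o e).
- by move=> k; exact: oO.
- rewrite -OT; apply/seteqP; split => z [k _ Oz]; first by exists (e k).
  have [k' _ ek'] : range e k by rewrite eT.
  by exists k' => //=; rewrite ek'.
by exists (e \o s).
Qed.

(** Either [hartogs T] is as small as [nat * T], or it embeds in a well-order [L]
    larger than [nat * T] whose initial segments are at most [nat * T].  Countable
    subsets of [L] are bounded, so the unions of the cover along the initial
    segments of [L] stabilize, which leaves a subcover of size [nat * T]. *)
Lemma covers_reduce_hartogs (Z : topologicalType) (T : Type) (t0 : T) (h0 : hartogs T) :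
  discretely_lindelof Z -> covers_reduce Z (nat * T) ->
  covers_reduce Z (nat * hartogs T).
Proof.
move=> dlZ red.
have [HT|nHT] := pselect ([set: hartogs T] #<= [set: nat * T]).
  apply: (covers_reduce_le (0%N, h0)) red.
  exact: card_le_trans (nat_prod_le (0%N, t0) HT) (nat_prod_absorb T).
have [L [lt [wo nLT seg LH]]] := wo_short nHT.
have [x0 _] : [set: L] !=set0.
  by apply/set0P/eqP => L0; apply: nLT; rewrite L0; exact: card_ge0.
have HL : [set: hartogs T] #<= [set: L].
  by apply: hartogs_least => LT; apply: nLT; exact: card_le_trans LT (nat_prod_ge T).
apply: (covers_reduce_le (0%N, h0) (nat_prod_le x0 HL)) => O oO OT.
pose U x : set Z := \bigcup_(k in [set k : nat * L | ~ lt x k.2]) O k.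
have [wf tr tot] := wo.
have [||||x Ux] := @increasing_cover_stabilizes Z L lt U x0 dlZ wo.
- move=> s; have [|x xs] := wo_short_bounded 0%N (0%N, t0) (J := range s)
      (nat_prod_absorb T) wo nLT seg; first exact: card_image_le.
  by exists x => n; apply: xs; exists n.
- by move=> x; apply: bigcup_open.
- by move=> x y xy z [k /= nxk Okz]; exists k => //= /(tr _ _ _ xy).
- rewrite -OT; apply/seteqP; split => z [k]; first by move=> _ [l _ Ol]; exists l.
  move=> _ Ok; exists k.2 => //; exists k => //=; exact: strict_wo_irr.
(* The indices up to [x] form a set of size at most [nat * T], to which the
   hypothesis applies. *)
pose S := [set y | ~ lt x y].
have SK : [set: nat * set_type S] #<= [set: nat * T].
  apply: card_le_trans (nat_prod_absorb T); apply: nat_prod_le; first exact: (0%N, t0).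
  rewrite (card_le_eql (card_setT S)).
  have : [set y | lt y x] `|` [set x] #<= [set: nat * (nat * T)].
    rewrite -bigcup2E; apply: (card_le_bigcup 0%N (0%N, t0)) => //.
    move=> [|[|i]] _ //=.
    apply: card_le_trans (countable1 x) _.
    by apply: (@card_le_injective _ _ _ _ (fun n => (n, t0))) => // n k _ _ [].
  move=> /card_le_trans/(_ (nat_prod_absorb T)); apply: card_le_trans.
  apply: subset_card_le => y nxy; case: (tot x y) => [//|->|]; [by right|by left].
have Sx : S x by exact: strict_wo_irr.
have [||s sT] := covers_reduce_le (0%N, SigSub (mem_set Sx)) SK red
  (O := fun k => O (k.1, set_val k.2)); first by [].
  rewrite -Ux; apply/seteqP; split => z; first by move=> [k _ Ok]; exists (k.1, set_val k.2) => //=; exact: (set_valP k.2).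
  by move=> [[n y] /= Sy Oz]; exists (n, SigSub (mem_set (Sy : S y))).
by exists (fun n => ((s n).1, set_val (s n).2)).
Qed.

Lemma hartogs_inhabited (T : Type) : exists h : hartogs T, True.
Proof.
have w0 : @well_ordering T (fun=> false, fun _ _ => false).
  by move=> A A0 [x /A0].
by exists (SigSub (mem_set (imageP (@order_type T) w0))).
Qed.

Lemma aleph_inhabited n : exists a : aleph n, True.
Proof. by case: n => [|n]; [exists 0%N|exact: hartogs_inhabited]. Qed.

Lemma covers_reduce_aleph (Z : topologicalType) n :
  discretely_lindelof Z -> covers_reduce Z (nat * aleph n).
Proof.
move=> dlZ; elim: n => [|n IH].
  apply: (@covers_reduce_le _ nat) => //; first exact: (0%N, 0%N).
    exact: countableP.
  by move=> O _ OT; exists id.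
have [a0 _] := aleph_inhabited n; have [h0 _] := hartogs_inhabited (aleph n).
exact: covers_reduce_hartogs.
Qed.

(** Otherwise each [aleph n] is at most the continuum, by minimality of the Hartogs
    numbers, and so is their countable union. *)
Lemma continuum_le_aleph :
  card_lt continuum aleph_omega -> exists n, [set: continuum] #<= [set: aleph n].
Proof.
move=> [_ nlt]; apply: contrapT => nC; apply: nlt.
have alephC n : [set: aleph n] #<= [set: continuum].
  case: n => [|n]; first exact: continuum_nat.
  by apply: hartogs_least => CA; apply: nC; exists n.
have f n : {f : aleph n -> continuum | injective f}.
  apply: cid; have [f fI] := card_le_injectiveP (fun=> false) (alephC n).
  by exists f => x y; exact: fI.
apply: card_le_trans continuum_prod.
apply: (@card_le_trans _ (nat * continuum)%type _ setT).
  apply: (@card_le_injective _ (nat * continuum) _ _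
    (fun u => (projT1 u, sval (f (projT1 u)) (projT2 u)))) => //.
  move=> [n x] [m y] _ _ /= [nm]; subst m; by move=> /(svalP (f n)) ->.
have [g gI] := card_le_injectiveP (fun=> false : bool) continuum_nat.
apply: (@card_le_injective _ _ _ _ (fun k => (g k.1, k.2))) => //.
by move=> [n x] [m y] _ _ /= [/gI -> // ->].
Qed.

Lemma covers_reduce_continuum (Z : topologicalType) :
  discretely_lindelof Z -> card_lt continuum aleph_omega ->
  covers_reduce Z continuum.
Proof.
move=> dlZ /continuum_le_aleph [n Cn].
apply: (covers_reduce_le ((fun=> false) : continuum) _ (covers_reduce_aleph dlZ)).
exact: card_le_trans Cn (nat_prod_ge _).
Qed.

(** * Separating points of a regular space by open sets *)

Lemma closure_open_meets (T : topologicalType) (A O : set T) (x : T) :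
  closure A x -> open O -> O x -> exists y, A y /\ O y.
Proof. by move=> cA oO Ox; have [y [Ay Oy]] := cA O (open_nbhs_nbhs (conj oO Ox)); exists y. Qed.

Lemma regular_shrink (X : topologicalType) (U : set X) (x : X) :
  @regular_space X -> open U -> U x ->
  exists V, [/\ open V, V x & closure V `<=` U].
Proof.
move=> reg oU Ux; have [B Bx BU] := reg x U (open_nbhs_nbhs (conj oU Ux)).
exists B^°; split; first exact: open_interior.
  exact: Bx.
by apply: subset_trans BU; apply: closureS; exact: interior_subset.
Qed.

Lemma regular_avoid (X : topologicalType) (p q : X) :
  accessible_space X -> @regular_space X -> p <> q ->
  exists U, [/\ open U, U q & ~ closure U p].
Proof.
move=> T1 reg /eqP; rewrite eq_sym => /T1 [A [oA /set_mem qA /set_mem pA]].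
have [V [oV Vq VA]] := regular_shrink reg oA qA.
by exists V; split => // /VA.
Qed.

Definition closures_disjoint (X : topologicalType) (V U : set X) : Prop :=
  [/\ open V, open U & forall x, closure V x -> ~ closure U x].

Lemma regular_separate (X : topologicalType) (p q : X) :
  accessible_space X -> @regular_space X -> p <> q ->
  exists V U, [/\ closures_disjoint V U, V p & U q].
Proof.
move=> T1 reg pq; have [U [oU Uq nUp]] := regular_avoid T1 reg pq.
have [V [oV Vp VU]] := regular_shrink reg (closed_openC (@closed_closure _ U)) nUp.
by exists V, U.
Qed.

Definition codiag_box (X : topologicalType) (V U : set X) :
  set (set_type (codiagonal X)) := [set z | V (set_val z).1 /\ U (set_val z).2].

Lemma open_codiag_box (X : topologicalType) (V U : set X) :
  open V -> open U -> open (codiag_box V U).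
Proof.
move=> oV oU; exists (V `*` U) => //.
rewrite openE => -[a b] [/= Va Ub]; exists (V, U) => //.
by split; apply: open_nbhs_nbhs.
Qed.

Lemma codiag_box_nbhs (X : topologicalType) (O : set (set_type (codiagonal X))) z :
  open O -> O z -> exists V U, [/\ open V, open U, codiag_box V U z &
    codiag_box V U `<=` O].
Proof.
move=> [ O' oO' <-] O'z; move: oO'; rewrite openE => /(_ _ O'z) [[A B] [/= Az Bz] AB].
exists A^°, B^°; split; [exact: open_interior..|by []|].
by move=> y [/interior_subset Ay /interior_subset By]; exact: AB.
Qed.

Definition codiag_pair (X : topologicalType) (p q : X) (pq : p <> q) :
  set_type (codiagonal X) := SigSub (mem_set (pq : codiagonal X (p, q))).

Lemma codiag_neq (X : topologicalType) (z : set_type (codiagonal X)) :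
  (set_val z).1 <> (set_val z).2.
Proof. exact: (@set_valP _ _ z). Qed.

Lemma codiag_separating_sequence (X : topologicalType)
    (A : set (set_type (codiagonal X))) :
  accessible_space X -> @regular_space X -> lindelof_space (set_type A) ->
  exists V U : nat -> set X, (forall n, closures_disjoint (V n) (U n)) /\
    A `<=` \bigcup_n codiag_box (V n) (U n).
Proof.
move=> T1 reg lA.
pose I := {VU : set X * set X | closures_disjoint VU.1 VU.2}.
have d0 : closures_disjoint (@set0 X) set0.
  by split; [exact: open0..|move=> x; rewrite closure0].
pose O (i : I) := codiag_box (sval i).1 (sval i).2.
have [||s As] := lindelof_subcover (O := O) (exist _ (set0, set0) d0 : I) lA.
- by move=> [[V U] [oV oU VU]]; exact: open_codiag_box.
- move=> z _; have [V [U [VU Vz Uz]]] := regular_separate T1 reg (@codiag_neq _ z).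
  by exists (exist _ (V, U) VU).
exists (fun n => (sval (s n)).1), (fun n => (sval (s n)).2); split => // n.
exact: svalP (s n).
Qed.

(** The pairs of distinct points of a discrete set form a discrete set of pairs;
    the countably many boxes that cover its closure separate the points of the
    closure of the set. *)
Lemma closure_discrete_continuum (X : topologicalType) (E : set X) :
  accessible_space X -> @regular_space X ->
  discretely_lindelof (set_type (codiagonal X)) ->
  discrete_space (set_type E) -> closure E #<= [set: continuum].
Proof.
move=> T1 reg dL dE; pose D := codiag_box E E.
have dD : discrete_space (set_type D).
  apply: discrete_space_isolated => z [Ez1 Ez2].
  have [V [oV Vz VE]] := isolated_of_discrete_space dE Ez1.
  have [U [oU Uz UE]] := isolated_of_discrete_space dE Ez2.
  exists (codiag_box V U); split => //; first exact: open_codiag_box.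
  move=> y [[Vy Uy] [Ey1 Ey2]]; apply: val_inj.
  have y1 : (set_val y).1 = (set_val z).1 by apply: VE.
  have y2 : (set_val y).2 = (set_val z).2 by apply: UE.
  by move: y1 y2; rewrite !set_valE; case: (\val y) (\val z) => [? ?] [? ?] /= -> ->.
have [V [U [VU DVU]]] := codiag_separating_sequence T1 reg (dL _ dD).
apply: (@card_le_injective _ _ _ _ (fun x n => `[< U n x >])) => // x y Ex Ey xy.
apply: contrapT => nxy.
have [|n _ [/= Vx Uy]] := DVU (codiag_pair nxy).
  move=> O; rewrite nbhsE => -[ O1 [oO1 O1z] O1O].
  have [A [B [oA oB [/= Ax By] AB]]] := codiag_box_nbhs oO1 O1z.
  have [A' [B' [[oA' oB' dA'B'] A'x B'y]]] := regular_separate T1 reg nxy.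
  have [a [Ea [Aa A'a]]] := closure_open_meets Ex (openI oA oA') (conj Ax A'x).
  have [b [Eb [Bb B'b]]] := closure_open_meets Ey (openI oB oB') (conj By B'y).
  have nab : a <> b.
    by move=> ab; apply: (dA'B' a); apply: subset_closure => //; rewrite ab.
  by exists (codiag_pair nab); split => //; apply/O1O/AB.
have [_ _ d] := VU n; apply: (d x); first exact: subset_closure.
apply: subset_closure; apply: asboolW.
by rewrite (congr1 (fun c => c n) xy); apply/asboolT.
Qed.

(** For a continuum-sized family [F] the greedy choice is indexed by the
    sequences of members of [F], each prescribing a countable part of [F] that
    both coordinates must miss.  A pair [(p, q)] that the new family does not
    separate is missed by the chosen neighbourhoods and by the closure of the
    chosen set, so the chosen set answers every sequence of members of [F] whose
    closures miss [p]; as its closure is Lindelöf, some point of this closure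
    answers them all at once. *)
Lemma refine_family (X : topologicalType) (F : set (set X)) :
  accessible_space X -> @regular_space X ->
  discretely_lindelof (set_type (codiagonal X)) ->
  F `<=` open -> F #<= [set: continuum] ->
  exists F' : set (set X), [/\ F `<=` F', F' `<=` open, F' #<= [set: continuum] &
    forall p q, p <> q -> (forall U, F' U -> U q -> closure U p) ->
    exists x U, [/\ F' U, U x, ~ closure U p &
      forall V, F V -> V x -> closure V p]].
Proof.
move=> T1 reg dL oF FC; pose Z := set_type (codiagonal X).
have F0C : F `|` [set set0] #<= [set: continuum].
  by apply: continuumU => //; apply: countable_le_continuum; exact: countable1.
have [e eF] := card_le_enum (or_intror erefl : (F `|` [set set0]) set0) F0C.
have oe c : open (e c).
  have : range e (e c) by exists c.
  by rewrite eF => -[/oF|->] //; exact: open0.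
have [c0 ec0] : exists c, e c = set0.
  by have : range e set0 by [rewrite eF; right]; move=> [c _ <-]; exists c.
have /choice [N NP] : forall z : Z, exists U : set X,
    [/\ open U, U (set_val z).2 & ~ closure U (set_val z).1].
  by move=> z; apply: regular_avoid => //; exact: codiag_neq.
have [lt wo] := strict_wo_exists (nat -> continuum).
pose S (s : nat -> continuum) : set Z :=
  [set z | forall n, ~ e (s n) (set_val z).1 /\ ~ e (s n) (set_val z).2].
have [|D [dD _ DC DS]] := @greedy_discrete Z _ lt S
    (fun z => codiag_box (~` closure (N z)) (N z)) wo.
  move=> s z _; have [oN Nz nNz] := NP z; split => //.
  by apply: open_codiag_box => //; apply: closed_openC; exact: closed_closure.
have [V [U [VU DVU]]] := codiag_separating_sequence T1 reg (dL _ dD).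
exists (F `|` (N @` D `|` (range U `|` range V))); split.
- by move=> A FA; left.
- move=> A [/oF//|[[z _ <-]|[[n _ <-]|[n _ <-]]]]; first by case: (NP z).
    by case: (VU n).
  by case: (VU n).
- apply: continuumU => //; apply: continuumU.
    apply: card_le_trans (card_image_le _ _) _.
    exact: card_le_trans DC continuum_pow_nat.
  by apply: continuumU; apply: card_le_trans (card_image_le _ _) continuum_nat.
move=> p q pq avoid; pose z0 := codiag_pair pq.
have nW : ~ (\bigcup_(z in D) codiag_box (~` closure (N z)) (N z)) z0.
  move=> [z Dz [/= nNp Nq]]; apply: nNp; apply: avoid Nq.
  by right; left; exists z.
have ncD : ~ closure D z0.
  move=> /DVU [n _ [/= Vp Uq]]; have [_ _ d] := VU n.
  apply: (d p); first exact: subset_closure.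
  by apply: avoid Uq; right; right; left; exists n.
have eavoid c : e c q -> closure (e c) p.
  have : range e (e c) by exists c.
  by rewrite eF => -[Fc|->//]; apply: avoid; left.
have meet s : (forall n, ~ closure (e (s n)) p) -> exists z, D z /\ S s z.
  move=> sp; case: (DS s) => [[z []]|sub]; first by exists z.
  have [|//|//] := sub z0; move=> n; split => /= [ep|/eavoid]; last exact: sp.
  by apply: (sp n); exact: subset_closure.
have [z [cDz zP]] : exists z, closure D z /\ forall c, ~ closure (e c) p -> ~ e c (set_val z).1 /\ ~ e c (set_val z).2.
  apply: contrapT => nz.
  pose O c : set Z := if pselect (closure (e c) p) then set0 else
    codiag_box (e c) setT `|` codiag_box setT (e c).
  have oO c : open (O c).
    rewrite /O; case: pselect => ?; first exact: open0.
    by apply: openU; apply: open_codiag_box => //; exact: openT.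
  have [|s Ds] := lindelof_subcover c0 (dL _ dD) oO.
    move=> z cDz; apply: contrapT => nO; apply: nz; exists z; split => // c nc.
    split=> ecz; apply: nO; exists c => //; rewrite /O; case: pselect => // ?.
      by left.
    by right.
  (* The countably many prescriptions that defeat the points of the closure form a
     single requirement once the irrelevant ones are replaced by the empty set;
     a chosen point meets it. *)
  pose s' n := if pselect (closure (e (s n)) p) then c0 else s n.
  have [n|z [Dz Sz]] := meet s'.
    by rewrite /s'; case: pselect => // ?; rewrite ec0 closure0.
  have [n _] := Ds _ (subset_closure Dz).
  have := Sz n; rewrite /O /s'; case: pselect => // ? [nz1 nz2] [[/nz1]|[_ /nz2]] //.
have [n _ [Vz Uz]] := DVU _ cDz.
have zF A x : (x = (set_val z).1 \/ x = (set_val z).2) -> F A -> A x -> closure A p.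
  move=> xz FA Ax; apply: contrapT => nA.
  have : range e A by [rewrite eF; left]; move=> [c _ eA].
  have [] := zP c; first by rewrite eA.
  by rewrite eA; case: xz Ax => ->.
have [Up|nUp] := pselect (closure (U n) p); last first.
  exists (set_val z).2, (U n); split => //; first by right; right; left; exists n.
  by move=> A; apply: zF; right.
exists (set_val z).1, (V n); split => //; first by right; right; right; exists n.
  by move=> Vp; have [_ _ d] := VU n; exact: (d p).
by move=> A; apply: zF; left.
Qed.

(** * A separating family of size continuum *)

(** If no separating family appears along a chain of refinements longer than the
    continuum, a pair that none of the families separates yields a right-separated
    sequence of the same length.  A discrete subset of this sequence is chosen
    greedily; it is bounded, since its closure has size at most the continuum,
    and yet its closure contains a whole tail of the sequence. *)
Lemma separating_family_continuum (X : topologicalType) :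
  accessible_space X -> @regular_space X ->
  discretely_lindelof (set_type (codiagonal X)) ->
  exists F : set (set X), [/\ F `<=` open, F #<= [set: continuum] &
    forall p q, p <> q -> exists U, [/\ F U, U q & ~ closure U p]].
Proof.
move=> T1 reg dL.
have [L [lt [wo nLC seg _]]] := wo_short (@cantor continuum).
have [x0 _] : [set: L] !=set0.
  by apply/set0P/eqP => L0; apply: nLC; rewrite L0; exact: card_ge0.
have /choice [R RP] : forall F : set (set X), exists F' : set (set X),
    F `<=` open -> F #<= [set: continuum] ->
    [/\ F `<=` F', F' `<=` open, F' #<= [set: continuum] &
    forall p q, p <> q -> (forall U, F' U -> U q -> closure U p) ->
    exists x U, [/\ F' U, U x, ~ closure U p &
      forall V, F V -> V x -> closure V p]].
  move=> F; have [oF|noF] := pselect (F `<=` open); last by exists F => /noF.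
  have [FC|nFC] := pselect (F #<= [set: continuum]); last by exists F => _ /nFC.
  by have [F' F'P] := refine_family T1 reg dL oF FC; exists F'.
have [||G GE] := @wo_recursion L lt (set (set X))
  (fun i G A => A = R (\bigcup_(j in [set j | lt j i]) G j)) set0 wo.
- by move=> i G G' A GG' ->; congr R; apply: eq_bigcupr => j; exact: GG'.
- by move=> i G; eexists.
have [wf tr tot] := wo.
have Gok i : G i `<=` open /\ G i #<= [set: continuum].
  elim/(well_founded_ind wf): i => i IH; rewrite GE.
  have [||//] := RP (\bigcup_(j in [set j | lt j i]) G j).
    by move=> U [j /IH [oG _]]; exact: oG.
  by apply: continuum_bigcup => [|j /IH []].
have GP i := RP (\bigcup_(j in [set j | lt j i]) G j).
have {}GP i : (\bigcup_(j in [set j | lt j i]) G j) `<=` G i /\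
    forall p q, p <> q -> (forall U, G i U -> U q -> closure U p) ->
    exists x U, [/\ G i U, U x, ~ closure U p &
      forall V, (\bigcup_(j in [set j | lt j i]) G j) V -> V x -> closure V p].
  have [||sub _ _ H] := GP i; last by rewrite -GE in sub H.
    by move=> U [j _]; case: (Gok j) => oG _; exact: oG.
  by apply: continuum_bigcup => [|j _]; [exact: seg|case: (Gok j)].
pose O i : set (set_type (codiagonal X)) :=
  \bigcup_(U in G i) codiag_box (~` closure U) U.
have bounded (J : set L) : J #<= [set: continuum] -> exists i, forall j, J j -> ~ lt i j.
  move=> JC; exact: (wo_short_bounded ((fun=> false) : continuum) (fun=> false) continuum_prod wo nLC seg JC).
have [OT|nOT] := pselect (\bigcup_i O i = setT).
  have [|||i Oi] := increasing_cover_stabilizes x0 dL wo _ _ _ OT.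
  - move=> s; have [|i ib] := bounded (range s).
      by apply: countable_le_continuum; exact: card_image_le.
    by exists i => n; apply: ib; exists n.
  - move=> i; apply: bigcup_open => U GU; have oU : open U by case: (Gok i) => oG _; exact: oG.
    by apply: open_codiag_box => //; apply: closed_openC; exact: closed_closure.
  - move=> i j ij z [U GU zU]; exists U => //.
    by have [sub _] := GP j; apply: sub; exists i.
  exists (G i); case: (Gok i) => oG GC; split => // p q pq.
  have [U GU [/= nUp Uq]] : O i (codiag_pair pq) by rewrite Oi.
  by exists U.
exfalso.
have [z nz] : exists z, ~ (\bigcup_i O i) z.
  apply: contrapT => H; apply: nOT; apply/seteqP; split => // z _.
  by apply: contrapT => nz; apply: H; exists z.
set p := (set_val z).1; set q := (set_val z).2.
have pq : p <> q by exact: codiag_neq.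
have /choice [xU xUP] : forall i, exists xU : X * set X,
    [/\ G i xU.2, xU.2 xU.1, ~ closure xU.2 p &
      forall V, (\bigcup_(j in [set j | lt j i]) G j) V -> V xU.1 -> closure V p].
  move=> i; have [_ /(_ p q pq) [|x [U H]]] := GP i; last by exists (x, U).
  by move=> U GU Uq; apply: contrapT => nUp; apply: nz; exists i => //; exists U.
pose x i := (xU i).1; pose U i := (xU i).2.
have Ux i : U i (x i) by case: (xUP i).
have oU i : open (U i) by case: (xUP i) => GU _ _ _; case: (Gok i) => oG _; exact: oG.
(* [U i] belongs to the families refined at stage [j] and its closure misses [p],
   so [x j] was chosen outside it. *)
have right_sep i j : lt i j -> ~ U i (x j).
  move=> ij Uj; case: (xUP j) => _ _ _ /(_ (U i)) H.
  case: (xUP i) => GU _ nUp _; apply: nUp; apply: H => //.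
  by exists i.
have xI i j : x i = x j -> i = j.
  by case: (tot i j) => [/right_sep H E|//|/right_sep H E]; case: H; rewrite -?E // E.
have /choice [W WP] : forall y, exists A, forall i, y = x i -> A = U i.
  move=> y; have [[i ->]|ny] := pselect (exists i, y = x i).
    by exists (U i) => j /xI ->.
  by exists set0 => i yi; case: ny; exists i.
have [|E [dE Esub _ Egr]] := @greedy_discrete X L lt (fun i => [set x i]) W wo.
  by move=> i _ ->; rewrite (WP _ i erefl).
have clE := closure_discrete_continuum T1 reg dL dE.
have [|m mJ] := bounded [set i | E (x i)].
  apply: card_le_trans clE; apply: (@card_le_injective _ _ _ _ x).
    by move=> i Ei; exact: subset_closure.
  by move=> i j _ _; exact: xI.
(* Beyond all the chosen indices a point of the sequence is not chosen, and the
   neighbourhoods of the chosen points miss it; only the closure remains. *)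
have tail i : lt m i -> closure E (x i).
  move=> mi; case: (Egr i) => [[_ [/[swap] -> Ei]]|/(_ (x i) erefl) [//|[y Ey Wy]]].
    by have := mJ i Ei.
  have [j _ yj] := Esub y Ey; move: Wy; rewrite (WP _ _ yj) => Ui.
  rewrite yj in Ey; case: (tot i j) => [ij|ij|ji].
  + by case: (mJ j Ey); exact: tr ij.
  + by case: (mJ j Ey); rewrite -ij.
  + by case: (right_sep _ _ ji).
apply: nLC; have -> : [set: L] = [set j | lt j m] `|` ([set m] `|` [set j | lt m j]).
  by apply/seteqP; split => // i _; case: (tot i m) => [|->|]; [left|right; left|right; right].
apply: continuumU => //; apply: continuumU.
  by apply: countable_le_continuum; exact: countable1.
apply: card_le_trans clE; apply: (@card_le_injective _ _ _ _ x) => //.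
by move=> i j _ _; exact: xI.
Qed.

(** * The co-diagonal is Lindelöf *)

(** A separating family of size continuum is an open cover of the co-diagonal by
    boxes; a countable subcover assigns distinct subsets of [nat] to distinct
    points of [X], so any neighbourhood assignment on the co-diagonal is a cover
    of size at most the continuum. *)
Lemma codiagonal_lindelof (X : topologicalType) :
  card_lt continuum aleph_omega -> accessible_space X -> @regular_space X ->
  discretely_lindelof (set_type (codiagonal X)) ->
  lindelof_space (set_type (codiagonal X)).
Proof.
move=> hc T1 reg dL; have red := covers_reduce_continuum dL hc.
have [F [oF FC Fsep]] := separating_family_continuum T1 reg dL.
have F0C : F `|` [set set0] #<= [set: continuum].
  by apply: continuumU => //; apply: countable_le_continuum; exact: countable1.
have [e eF] := card_le_enum (or_intror erefl : (F `|` [set set0]) set0) F0C.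
have oe c : open (e c).
  have : range e (e c) by exists c.
  by rewrite eF => -[/oF|->] //; exact: open0.
have [||s sT] := red (fun c => codiag_box (~` closure (e c)) (e c)).
- by move=> c; apply: open_codiag_box => //; apply: closed_openC; exact: closed_closure.
- apply/seteqP; split => // z _; have [U [FU Uz nUz]] := Fsep _ _ (@codiag_neq _ z).
  have : range e U by rewrite eF; left.
  by move=> [c _ cU]; exists c => //; rewrite cU.
have XC : [set: X] #<= [set: continuum].
  apply: (@card_le_injective _ _ _ _ (fun x n => `[< e (s n) x >])) => // x y _ _ xy.
  apply: contrapT => nxy.
  have [n _ [/= nx ey]] : (\bigcup_n codiag_box (~` closure (e (s n))) (e (s n))) (codiag_pair nxy).
    by rewrite sT.
  apply: nx; apply: subset_closure; apply: asboolW.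
  by rewrite (congr1 (fun c => c n) xy); apply/asboolT.
have ZC : [set: set_type (codiagonal X)] #<= [set: continuum].
  have [f fI] := card_le_injectiveP (fun=> false) XC.
  apply: card_le_trans continuum_prod.
  apply: (@card_le_injective _ _ _ _ (fun z => (f (set_val z).1, f (set_val z).2))) => //.
  move=> z y _ _ /= [/fI e1 /fI e2]; apply: val_inj; move: (e1 I I) (e2 I I).
  by rewrite !set_valE; case: (\val z) (\val y) => [? ?] [? ?] /= -> ->.
apply: lindelof_of_assignments => z0 O oO Oz.
apply: (covers_reduce_le z0 ZC red oO).
by apply/seteqP; split => // z _; exists z.
Qed.

(** Each point of [X] is the first coordinate of a pair of distinct points, unless
    [X] has at most one point. *)
Lemma lindelof_of_codiagonal (X : topologicalType) :
  lindelof_space (set_type (codiagonal X)) -> lindelof_space X.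
Proof.
move=> lZ; apply: lindelof_of_assignments => x0 O oO Ox.
have [[y ny]|one] := pselect (exists y, x0 <> y); last first.
  exists (fun=> x0); apply/seteqP; split => // x _; exists 0%N => //.
  by have <- : x0 = x by apply: contrapT => nx; apply: one; exists x.
have [||s sT] := lindelof_sequence (O := fun x => codiag_box (O x) setT) x0 lZ.
- by move=> x; apply: open_codiag_box => //; exact: openT.
- by apply/seteqP; split => // z _; exists (set_val z).1.
exists s; apply/seteqP; split => // x _.
have [w nxw] : exists w, x <> w.
  have [<-|nx] := pselect (x0 = x); first by exists y.
  by exists x0 => /esym.
have : setT (codiag_pair nxw) by [].
by rewrite -sT => -[n _ [/= Osx _]]; exists n.
Qed.

(** The square is the union of the co-diagonal and of a copy of [X]. *)
Lemma square_lindelof_of_codiagonal (X : topologicalType) :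
  lindelof_space (set_type (codiagonal X)) -> lindelof_space (X * X)%type.
Proof.
move=> lZ; apply: lindelof_of_assignments => x0 O oO Ox.
have [||s sT] := lindelof_sequence
  (O := fun x => (set_val : set_type (codiagonal X) -> _) @^-1` O x) x0 lZ.
- by move=> x; exists (O x).
- by apply/seteqP; split => // z _; exists (set_val z).
have [||t tT] := lindelof_sequence
  (O := fun x => (fun x => (x, x)) @^-1` O (x, x)) x0.1 (lindelof_of_codiagonal lZ).
- move=> x; apply: open_comp (oO _) => y _.
  by apply: cvg_pair; exact: cvg_id.
- by apply/seteqP; split => // x _; exists x.
(* Odd indices cover the co-diagonal and even ones the diagonal. *)
exists (fun n => if odd n then s n./2 else (t n./2, t n./2)).
apply/seteqP; split => // -[x y] _.
have [xy|nxy] := pselect (x = y).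
  have : setT x by []; rewrite -tT => -[n _ Ot]; exists n.*2 => //.
  by rewrite odd_double doubleK -xy.
have : setT (codiag_pair nxy) by []; rewrite -sT => -[n _ Os]; exists n.*2.+1 => //.
by rewrite /= odd_double /= uphalf_double.
Qed.

(** * Regular Lindelöf spaces are normal *)

(** Cover [X] by countably many open sets whose closures each miss [A] or [B].
    Removing from each set that is far from [B] the closures of the earlier sets
    that are far from [A], and conversely, makes the two unions disjoint. *)
Lemma regular_lindelof_normal (X : topologicalType) :
  @regular_space X -> lindelof_space X -> normal_space X.
Proof.
move=> reg lX; apply/(@normal_openP Rdefinitions.R) => A B cA cB AB.
have [[x0 _]|nX] := pselect ([set: X] !=set0); last first.
  exists set0, set0; split; rewrite ?setI0 //; try exact: open0.
    by move=> x Ax; case: nX; exists x.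
  by move=> x Ax; case: nX; exists x.
have /choice [G GP] : forall x, exists V, [/\ open V, V x &
    closure V `&` A = set0 \/ closure V `&` B = set0].
  move=> x; have [Ax|nAx] := pselect (A x).
    have nBx : (~` B) x by move=> Bx; rewrite -[False]/(set0 x) -AB.
    have [V [oV Vx VB]] := regular_shrink reg (closed_openC cB) nBx.
    by exists V; split => //; right; apply/disjoints_subset.
  have [V [oV Vx VA]] := regular_shrink reg (closed_openC cA) nAx.
  by exists V; split => //; left; apply/disjoints_subset.
have [||s sT] := lindelof_sequence (O := G) x0 lX.
- by move=> x; case: (GP x).
- by apply/seteqP; split => // x _; exists x => //; case: (GP x).
pose far (C : set X) n := closure (G (s n)) `&` C = set0.
pose U C D := \bigcup_(n in far D)
  (G (s n) `&` ~` \bigcup_(m in [set m | (m <= n)%N /\ far C m]) closure (G (s m))).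
have oU C D : open (U C D).
  apply: bigcup_open => n _; apply: openI; first by case: (GP (s n)).
  apply: closed_openC; apply: closed_bigcup => [|m _]; last exact: closed_closure.
  apply: (@sub_finite_set _ _ `I_n.+1) => [m [mn _]|]; first exact: mn.
  exact: finite_II.
have UC C D : (forall n, far C n \/ far D n) -> C `<=` U C D.
  move=> CD x Cx; have : setT x by []; rewrite -sT => -[n _ Gx].
  have notfar m : far C m -> ~ closure (G (s m)) x.
    by move=> fm cx; rewrite -[False]/(set0 x) -fm.
  exists n.
    by case: (CD n) => // /notfar; case; exact: subset_closure.
  by split => // -[m [_ /notfar]].
have AorB n : far A n \/ far B n by case: (GP (s n)).
exists (U A B), (U B A); split; [exact: oU|exact: oU|exact: UC| |].
  by apply: UC => n; case: (AorB n); [right|left].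
apply/seteqP; split => // x [[n fn [Gn nn]] [m fm [Gm nm]]].
case: (leqP n m) => nm'.
  by apply: nm; exists n => //; exact: subset_closure.
by apply: nn; exists m; [split => //; exact: ltnW|exact: subset_closure].
Qed.

(** * A weaker second-countable Tychonoff topology *)

Local Notation Re := Rdefinitions.R.

(** The topology is the supremum of the initial topologies of the [f n].  It carries a
    uniformity, hence complete regularity, and finite intersections of preimages
    of rational intervals form a base. *)
Lemma coarser_second_countable (X : topologicalType) (f : nat -> X -> Re) :
  (forall n, continuous (f n)) ->
  (forall x y, x <> y -> exists n, f n x <> f n y) ->
  exists tau : Topological X, [/\ weaker_topology tau,
    tychonoff_space (Topological.Pack tau) &
    @second_countable (Topological.Pack tau)].
Proof.
move=> fc fsep.
pose Tc n : Uniform X := Uniform.class (initial_topology (f n)).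
pose Y : uniformType := sup_topology Tc.
have cvgY (F : set_system X) (x : X) : Filter F ->
    (forall n, F --> (x : initial_topology (f n))) -> F --> (x : Y).
  by move=> FF H; apply/cvg_sup.
have fcY n : continuous (f n : Y -> Re).
  move=> x A fA; have H : nbhs (x : Y) --> (x : Y) by [].
  have /(_ n) := (cvg_sup Tc x (nbhs_filter (x : Y))).1 H; apply.
  exact: (@initial_continuous X Re (f n) x A fA).
exists (Topological.class Y); split.
- move=> A; rewrite !openE => oA x /oA; rewrite /interior.
  suff : nbhs x --> (x : Y) by apply.
  apply: cvgY => n W [_ [[B oB <-] Bx BW]].
  by apply: filterS BW _; apply: (fc n x); exact: open_nbhs_nbhs.
- split; last exact: (@uniform_completely_regular Re Y).
  move=> x y /eqP /fsep [n nxy].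
  exists (f n @^-1` (~` [set f n y])); split.
  + apply: (@open_comp Y Re) => [z _|]; first exact: fcY.
    by apply: closed_openC; apply: accessible_closed_set1; apply: hausdorff_accessible; exact: Rhausdorff.
  + exact: mem_set.
  + by apply: mem_set => /=; apply.
- pose cell (k : nat * (rat * rat)) : set Y :=
    f k.1 @^-1` `]ratr k.2.1, ratr k.2.2[.
  pose box (s : seq (nat * (rat * rat))) : set Y := \bigcap_(k in [set` s]) cell k.
  have ocell k : open (cell k).
    apply: (@open_comp Y Re) => [z _|]; first exact: fcY.
    exact: interval_open.
  have obox s : open (box s).
    rewrite /box; elim: s => [|k s IH].
      by rewrite set_nil bigcap_set0; exact: openT.
    have -> : \bigcap_(j in [set` k :: s]) cell j = cell k `&` box s.
      apply/seteqP; split=> [y H|y [ky sy] j /=].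
        by split=> [|j js]; apply: H; rewrite /= inE ?eqxx // js orbT.
      by rewrite inE => /orP [/eqP ->|/sy].
    exact: openI.
  exists (range box); first by apply: card_le_trans (card_image_le _ _) _; exact: countableP.
  split; first by move=> _ [s _ <-].
  move=> x; apply: cvgY.
    apply: filter_from_filter.
      by exists setT; split => //; exists [::] => //; rewrite /box set_nil bigcap_set0.
    move=> _ _ [[s _ <-] sx] [[t _ <-] tx]; exists (box (s ++ t)).
      split; first by exists (s ++ t).
      by move=> k /=; rewrite mem_cat => /orP [/sx|/tx].
    by move=> y st; split=> k /= ks; apply: st; rewrite /= mem_cat ks ?orbT.
  move=> n W [_ [[B oB <-] Bx BW]].
  have /nbhs_ballP [e /= e0 eB] : nbhs (f n x) B by exact: open_nbhs_nbhs.
  have /rat_in_itvoo [a] : (f n x - e < f n x)%R by rewrite ltrBlDr ltrDl.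
  have /rat_in_itvoo [b] : (f n x < f n x + e)%R by rewrite ltrDl.
  rewrite !in_itv /= => /andP [xb bx] /andP [ax xa].
  exists (box [:: (n, (a, b))]).
    split; first by exists [:: (n, (a, b))].
    by move=> k /=; rewrite inE => /eqP -> /=; rewrite /cell /= in_itv /= xa xb.
  move=> y /(_ (n, (a, b))) H; apply: BW; apply: eB.
  have : cell (n, (a, b)) y by apply: H; rewrite /= inE.
  rewrite /cell /= in_itv /= => /andP [ay yb].
  by rewrite /ball /= ltr_distlC (lt_trans ax ay) (lt_trans yb bx).
Qed.

Lemma lindelof_setT (Z : topologicalType) :
  lindelof_space Z -> lindelof_space (set_type [set: Z]).
Proof.
move=> lZ; apply: lindelof_of_assignments => t0 O oO Ot.
pose g (z : Z) : set_type [set: Z] := SigSub (mem_set (I : setT z)).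
have [||s sT] := lindelof_sequence (O := fun t => g @^-1` O t) t0 lZ.
- by move=> t; have [W oW <-] := oO t.
- by apply/seteqP; split => // z _; exists (g z) => //; exact: Ot.
exists s; apply/seteqP; split => // t _.
have [n _ Os] : (\bigcup_n g @^-1` O (s n)) (set_val t) by rewrite sT.
exists n => //; move: Os => /=.
by have <- : g (set_val t) = t by exact: val_inj.
Qed.

(** Countably many boxes [V n * U n] with disjoint closures cover the co-diagonal, and
    a Urysohn function for each pair of closures separates the points of such a
    box. *)
Lemma separating_functions (X : topologicalType) :
  accessible_space X -> @regular_space X ->
  lindelof_space (set_type (codiagonal X)) ->
  exists f : nat -> X -> Re, (forall n, continuous (f n)) /\
    forall x y, x <> y -> exists n, f n x <> f n y.
Proof.
move=> T1 reg lZ.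
have normX := regular_lindelof_normal reg (lindelof_of_codiagonal lZ).
have [V [U [VU cov]]] := codiag_separating_sequence T1 reg (lindelof_setT lZ).
have /choice [f fP] : forall n, exists f : X -> Re, [/\ continuous f,
    forall x, closure (V n) x -> f x = 0%R & forall x, closure (U n) x -> f x = 1%R].
  move=> n; have [_ _ d] := VU n.
  have sepn : uniform_separator (closure (V n)) (closure (U n)).
    apply: normal_uniform_separator => //; try exact: closed_closure.
    by apply/seteqP; split => // x [/d].
  have [f [fc _ f0 f1]] := (@uniform_separatorP X Re _ _).1 sepn.
  by exists f; split => // x cx; [apply: f0|apply: f1]; exists x.
exists f; split=> [n|x y xy]; first by case: (fP n).
have [n _ [/= Vx Uy]] := cov (codiag_pair xy) I.
exists n; have [_ -> ] := fP n; last exact: subset_closure.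
move=> /(_ y (subset_closure Uy)) -> /esym/eqP; by rewrite oner_eq0.
Qed.

Lemma least_infinite_card_nat (P : Type -> Prop) :
  P nat -> least_infinite_card P nat.
Proof.
by move=> Pn; split => //; [exact: infinite_nat|move=> L /infiniteP].
Qed.

Theorem corollary3p4 (X : topologicalType)
    (hc : card_lt continuum aleph_omega)
    (hT1 : accessible_space X)
    (hreg : @regular_space X)
    (hdL : discretely_lindelof (set_type (codiagonal X))) :
  lindelof_space (set_type (codiagonal X)) /\
  is_lindelof_number (X * X)%type nat /\
  is_i_weight X nat.
Proof.
have lZ := codiagonal_lindelof hc hT1 hreg hdL.
split => //; split; apply: least_infinite_card_nat.
  exact: square_lindelof_of_codiagonal.
have [f [fc fsep]] := separating_functions hT1 hreg lZ.
have [tau [weak tych [B cB bB]]] := coarser_second_countable fc fsep.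
by exists tau; split => //; apply: least_infinite_card_nat; exists B.
Qed.
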